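(* Let $f:\mathbb{R}^N\times\mathbb{R}\to\mathbb{R}^N$ be $C^1$ with $f(x,t+T)=f(x,t)$ for all $x,t$, for some $T>0$ (this includes autonomous $f$), and let $x_\ast$ be a $T$-periodic solution of $\dot x(t)=f(x(t),t)$. Suppose the linearization $\dot y(t)=\partial_xf(x_\ast(t),t)y(t)$ has at least one real Floquet multiplier larger than $1$. Then for every $k\in\mathbb{R}$, the linearization $\dot y(t)=\partial_xf(x_\ast(t),t)y(t)+k[y(t)-y(t-T)]$ has a real Floquet multiplier larger than $1$; in particular $x_\ast$ is unstable as a solution of $\dot x(t)=f(x(t),t)+k[x(t)-x(t-T)]$.
   Context: Floquet multipliers of a linear $T$-periodic ODE are eigenvalues of its monodromy matrix; for the $T$-periodic delay equation they are the nonzero eigenvalues of the monodromy operator on $C([-T,0],\mathbb{C}^N)$, i.e. nonzero $\mu$ for which a nonzero solution with $y(t+T)=\mu y(t)$ exists. *)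

(* Defs.v *)
From HB Require Import structures.
From mathcomp Require Import all_boot all_order all_algebra.
From mathcomp Require Import all_classical all_reals all_analysis.
Set Implicit Arguments. Unset Strict Implicit. Unset Printing Implicit Defensive.
Import Order.TTheory GRing.Theory Num.Theory.
Import numFieldNormedType.Exports.
Local Open Scope ring_scope.

Section Floquet.
Variables (R : realType) (N : nat).
Notation vec := 'rV[R]_N.

Definition uncurry_f (f : vec -> R -> vec) : vec * R -> vec :=
  fun p => f p.1 p.2.

Definition C1 (f : vec -> R -> vec) : Prop :=
  (forall p : vec * R, differentiable (uncurry_f f) p) /\
  (forall v : vec * R, continuous (fun p : vec * R => 'D_v (uncurry_f f) p)).

Definition Dxf (f : vec -> R -> vec) (x : vec) (t : R) (y : vec) : vec :=
  'D_(y, 0) (uncurry_f f) (x, t).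

Definition is_solution (f : vec -> R -> vec) (x : R -> vec) : Prop :=
  forall t, derivable x t 1 /\ derive x t 1 = f (x t) t.

Definition solves_linearization (f : vec -> R -> vec) (xs : R -> vec)
  (y : R -> vec) : Prop :=
  forall t, derivable y t 1 /\ derive y t 1 = Dxf f (xs t) t (y t).

Definition solves_delayed_linearization (f : vec -> R -> vec) (xs : R -> vec)
  (k T : R) (y : R -> vec) : Prop :=
  forall t, derivable y t 1 /\
    derive y t 1 = Dxf f (xs t) t (y t) + k *: (y t - y (t - T)).

(* Phi is the principal fundamental matrix of the linearization
   (row convention: each row of Phi(t) is a solution, Phi(0) = I), so that
   every solution satisfies y(t) = y(0) *m Phi(t); the monodromy matrix
   is Phi(T). *)
Definition principal_fundamental (f : vec -> R -> vec) (xs : R -> vec)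
  (Phi : R -> 'M[R]_N) : Prop :=
  Phi 0 = 1%:M /\
  forall i : 'I_N, solves_linearization f xs (fun t => row i (Phi t)).

Definition ode_floquet_multiplier (f : vec -> R -> vec) (xs : R -> vec)
  (T mu : R) : Prop :=
  exists Phi, principal_fundamental f xs Phi /\ eigenvalue (Phi T) mu.

Definition dde_floquet_multiplier (f : vec -> R -> vec) (xs : R -> vec)
  (k T mu : R) : Prop :=
  mu != 0 /\
  exists y : R -> vec, solves_delayed_linearization f xs k T y /\
    (exists t, y t != 0) /\ (forall t, y (t + T) = mu *: y t).

End Floquet.

(* Main.v *)
Require Import Defs.
From HB Require Import structures.
From mathcomp Require Import all_boot all_order all_algebra.
From mathcomp Require Import all_classical all_reals all_analysis.
From mathcomp Require Import ring lra.
Import Order.TTheory GRing.Theory Num.Theory.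
Import numFieldNormedType.Exports.
Local Open Scope ring_scope.
Set Implicit Arguments.
Unset Strict Implicit.
Unset Printing Implicit Defensive.

(* Let mu0 > 1 be a real eigenvalue of the monodromy matrix Phi(T) of the
   linearization y' = A(t) y, A(t) = d_x f(xs(t), t), with eigenvector v.
   1. y(t) := v Phi(t) is a Floquet solution: y(t + T) = mu0 y(t).  Indeed
      y(. + T) and mu0 y both solve the linearization (its coefficients are
      T-periodic) and agree at t = 0; linear equations have unique solutions,
      which we prove with a Gronwall estimate on |w(t)|^2.
   2. For any c, z(t) := e^{ct} y(t) has z(t - T) = e^{-cT} z(t) / mu0, so z
      solves the delayed linearization y' = A(t) y + k [y(t) - y(t - T)] as
      soon as c = k (1 - e^{-cT} / mu0), and then z(t + T) = e^{cT} mu0 z(t).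
   3. By the intermediate value theorem this characteristic equation has a
      root c with e^{cT} mu0 > 1, which is the required Floquet multiplier. *)

Section Calculus.
Variable R : realType.

Lemma is_derive_expRM (C s : R) :
  is_derive s 1 (fun s : R => expR (C * s)) (expR (C * s) * C).
Proof.
have lin : is_derive s 1 (fun s : R => C * s) C.
  apply: DeriveDef; first by apply: derivableM => //; apply: derivable_id.
  rewrite deriveM // derive_id.
  have -> : (fun=> C) = cst C :> (R -> R) by [].
  by rewrite derive_cst scaler0 addr0 /GRing.scale /= mulr1.
exact: (is_derive1_comp (f := expR) (g := fun s => C * s)).
Qed.

Lemma is_derive_scale_fun m n (e : R -> R) (y : R -> 'M[R]_(m, n)) (t de : R) :
  is_derive t 1 e de -> derivable y t 1 ->
  derivable (fun s => e s *: y s) t 1 /\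
  'D_1 (fun s => e s *: y s) t = de *: y t + e t *: 'D_1 y t.
Proof.
move=> [de1 de2] dy.
have entryE i j : (fun s => (e s *: y s) i j) = e * (fun s => y s i j).
  by apply/funext => s; rewrite mxE.
have dyij i j : derivable (fun s => y s i j) t 1 := (derivable_mxP _ _ _).1 dy i j.
have dz : derivable (fun s => e s *: y s) t 1.
  apply/derivable_mxP => i j; rewrite entryE; exact: (derivableM de1 (dyij i j)).
split; first exact: dz.
rewrite (derive_mx dz) (derive_mx dy); apply/matrixP => i j; rewrite !mxE entryE.
rewrite (deriveM de1 (dyij i j)) de2 addrC; congr (_ + _); exact: mulrC.
Qed.

Lemma derivable_shift (V : normedModType R) (y : R -> V) (T t : R) :
  derivable y (t + T) 1 ->
  derivable (fun s => y (s + T)) t 1 /\ 'D_1 (fun s => y (s + T)) t = 'D_1 y (t + T).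
Proof.
rewrite /derivable /derive.
have -> : (fun h : R => h^-1 *: (((fun s => y (s + T)) \o shift t) (h *: 1) - y (t + T)))
   = (fun h : R => h^-1 *: ((y \o shift (t + T)) (h *: 1) - y (t + T))).
  by apply/funext => h /=; rewrite addrA.
by [].
Qed.

End Calculus.

Section Gronwall.
Variable R : realType.

(* Forward Gronwall inequality with zero initial value: a nonnegative g with
   g(0) = 0 and g' <= C g on [0, a] vanishes on [0, a], because
   exp(-C s) g(s) is nonincreasing there. *)
Lemma gronwall_forward (g : R -> R) (a C : R) :
  (forall s, derivable g s 1) -> (forall s, 0 <= g s) -> g 0 = 0 ->
  (forall s, 0 <= s <= a -> 'D_1 g s <= C * g s) ->
  forall s, 0 <= s <= a -> g s = 0.
Proof.
move=> dg g_ge0 g0 g'_le s /andP[s_ge0 s_le_a].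
pose h := (fun x => expR (- C * x)) * g.
have hE x : h x = expR (- C * x) * g x by [].
have dh (x : R) : is_derive x 1 h (expR (- C * x) * 'D_1 g x + g x * (expR (- C * x) * - C)).
  by have := @is_deriveM R R^o _ g x 1 _ _ (is_derive_expRM (- C) x) (derivableP (dg x)).
have h_noninc : h s <= h 0.
  apply: (@ler0_derive1_le_cc R h 0 a).
  - by move=> x _; have [] := dh x.
  - move=> x; rewrite in_itv /= => /andP[x_gt0 x_lt_a].
    rewrite derive1E (@derive_val _ _ _ _ _ _ _ (dh x)).
    have -> : expR (- C * x) * 'D_1 g x + g x * (expR (- C * x) * - C) =
       expR (- C * x) * ('D_1 g x - C * g x) by ring.
    rewrite pmulr_rle0 ?expR_gt0 // subr_le0; apply: g'_le.
    by rewrite !ltW.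
  - apply: continuous_subspaceT => x.
    apply: differentiable_continuous; apply/derivable1_diffP.
    by have [] := dh x.
  - by rewrite in_itv /= s_ge0 s_le_a.
  - by rewrite in_itv /= lexx (le_trans s_ge0 s_le_a).
  - exact: s_ge0.
move: h_noninc; rewrite !hE g0 mulr0 pmulr_rle0 ?expR_gt0 // => gs_le0.
by apply/eqP; rewrite eq_le gs_le0 g_ge0.
Qed.

(* Two-sided version, the backward half following by time reversal. *)
Lemma gronwall (g : R -> R) (a C : R) :
  (forall s, derivable g s 1) -> (forall s, 0 <= g s) -> g 0 = 0 ->
  (forall s, -a <= s <= a -> `|'D_1 g s| <= C * g s) ->
  forall s, -a <= s <= a -> g s = 0.
Proof.
move=> dg g_ge0 g0 g'_le s /andP[s_ge s_le].
have [s_ge0|s_lt0] := leP 0 s.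
  apply: (gronwall_forward (a := a) (C := C) dg) => //; last by rewrite s_ge0 s_le.
  move=> x /andP[x_ge0 x_le]; apply: le_trans (ler_norm _) (g'_le _ _).
  by apply/andP; split; lra.
pose gr := g \o -%R.
have dgr (x : R) : is_derive x 1 gr ('D_1 g (- x) * -1).
  exact: (is_derive1_comp (derivableP (dg (- x))) (is_deriveNid x 1)).
have -> : g s = gr (- s) by rewrite /gr /= opprK.
apply: (gronwall_forward (a := a) (C := C)).
- by move=> x; have [] := dgr x.
- by move=> x; apply: g_ge0.
- by rewrite /gr /= oppr0.
- move=> x /andP[x_ge0 x_le]; rewrite (@derive_val _ _ _ _ _ _ _ (dgr x)) mulrN1.
  apply: le_trans (g'_le (- x) _); first by rewrite -normrN ler_norm.
  by apply/andP; split; lra.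
- by apply/andP; split; lra.
Qed.

End Gronwall.

Section PartialDerivative.
Variables (R : realType) (N : nat) (f : 'rV[R]_N -> R -> 'rV[R]_N).
Hypothesis f_C1 : C1 f.

(* The partial derivative is the differential restricted to the x-directions,
   hence linear in the direction. *)
Lemma Dxf_diff x t y : Dxf f x t y = 'd (uncurry_f f) (x, t) (y, 0).
Proof. by rewrite /Dxf deriveE //; case: f_C1. Qed.

Lemma Dxf_add x t (y z : 'rV[R]_N) : Dxf f x t (y + z) = Dxf f x t y + Dxf f x t z.
Proof.
rewrite !Dxf_diff.
have -> : ((y + z, 0) : 'rV[R]_N * R) = (y, 0) + (z, 0) by congr (_, _); rewrite /= addr0.
by rewrite linearD.
Qed.

Lemma Dxf_scale x t (a : R) (y : 'rV[R]_N) : Dxf f x t (a *: y) = a *: Dxf f x t y.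
Proof.
rewrite !Dxf_diff.
have -> : ((a *: y, 0) : 'rV[R]_N * R) = a *: (y, 0) by congr (_, _); rewrite /= scaler0.
by rewrite linearZ.
Qed.

Lemma Dxf0 x t : Dxf f x t 0 = 0.
Proof. by rewrite Dxf_diff -[(0, 0)]/(0 : 'rV[R]_N * R) linear0. Qed.

Lemma Dxf_sum x t n (c : 'I_n -> R) (z : 'I_n -> 'rV[R]_N) :
  Dxf f x t (\sum_i c i *: z i) = \sum_i c i *: Dxf f x t (z i).
Proof.
elim/big_rec2: _ => [|i u v _ <-]; first exact: Dxf0.
by rewrite (Dxf_add x t (c i *: z i) v) (Dxf_scale x t (c i) (z i)).
Qed.

Lemma Dxf_coord x t (y : 'rV[R]_N) j :
  (Dxf f x t y) 0 j = \sum_i y 0 i * (Dxf f x t 'e_i) 0 j.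
Proof.
rewrite {1}(row_sum_delta y) Dxf_sum summxE.
by apply: eq_bigr => i _; rewrite mxE.
Qed.

Lemma Dxf_continuous (xs : R -> 'rV[R]_N) y :
  (forall t, derivable xs t 1) -> continuous (fun t => Dxf f (xs t) t y).
Proof.
case: f_C1 => f_diff Df_cont xs_der t.
apply: (@continuous_comp _ _ _ (fun t => (xs t, t)) ('D_(y, 0) (uncurry_f f))).
  apply: differentiable_continuous; apply: differentiable_pair; last exact: ex_diff.
  exact/derivable1_diffP.
exact: Df_cont.
Qed.

End PartialDerivative.

Lemma Dxf_periodic (R : realType) (N : nat) (f : 'rV[R]_N -> R -> 'rV[R]_N) (T : R) :
  (forall x t, f x (t + T) = f x t) -> forall x t z, Dxf f x (t + T) z = Dxf f x t z.
Proof.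
move=> f_per x t z; rewrite /Dxf /derive.
have -> : (fun h : R => h^-1 *: ((uncurry_f f \o shift (x, t + T)) (h *: (z, 0))
                                  - uncurry_f f (x, t + T)))
  = (fun h : R => h^-1 *: ((uncurry_f f \o shift (x, t)) (h *: (z, 0))
                           - uncurry_f f (x, t))).
  by apply/funext => h; rewrite /uncurry_f /= addrA !f_per.
by [].
Qed.

Section LinearizedSolutions.
Variables (R : realType) (N : nat) (f : 'rV[R]_N -> R -> 'rV[R]_N).
Hypothesis f_C1 : C1 f.
Variable xs : R -> 'rV[R]_N.
Notation solves := (solves_linearization f xs).

Lemma solves_lin_zero : solves 0.
Proof.
move=> t; split; first exact: derivable_cst.
by rewrite derive_cst Dxf0.
Qed.

Lemma solves_lin_add y z : solves y -> solves z -> solves (y + z).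
Proof.
move=> y_sol z_sol t; have [dy Dy] := y_sol t; have [dz Dz] := z_sol t.
split; first exact: derivableD.
rewrite (deriveD dy dz) Dy Dz; exact: esym (Dxf_add f_C1 (xs t) t (y t) (z t)).
Qed.

Lemma solves_lin_scale (a : R) y : solves y -> solves (a \*: y).
Proof.
move=> y_sol t; have [dy Dy] := y_sol t.
split; first exact: derivableZ.
by rewrite (deriveZ a dy) Dy (Dxf_scale f_C1 (xs t) t a (y t)).
Qed.

Lemma solves_lin_sum n (c : 'I_n -> R) (y : 'I_n -> R -> 'rV[R]_N) :
  (forall i, solves (y i)) -> solves (\sum_i c i \*: y i).
Proof.
move=> y_sol; apply: (big_ind solves); first exact: solves_lin_zero.
  exact: solves_lin_add.
by move=> i _; apply: solves_lin_scale.
Qed.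

Lemma solves_lin_shift (T : R) y :
  (forall x t, f x (t + T) = f x t) -> (forall t, xs (t + T) = xs t) ->
  solves y -> solves (fun s => y (s + T)).
Proof.
move=> f_per xs_per y_sol t; have [dy Dy] := y_sol (t + T).
have [dyT DyT] := derivable_shift dy.
split; first exact: dyT.
by rewrite DyT Dy xs_per (Dxf_periodic f_per).
Qed.

End LinearizedSolutions.

Lemma quadratic_form_bound (R : realType) n (u : 'I_n -> R) (b : 'I_n -> 'I_n -> R) (K : R) :
  (forall i j, `|b i j| <= K) ->
  `| \sum_j 2 * u j * \sum_i u i * b i j | <= 2 * n%:R * K * \sum_j u j ^+ 2.
Proof.
move=> b_le.
apply: (le_trans (ler_norm_sum _ _ _)).
apply: (@le_trans _ _ (\sum_j \sum_(i < n) K * (u j ^+ 2 + u i ^+ 2))).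
  apply: ler_sum => j _; rewrite mulr_sumr.
  apply: (le_trans (ler_norm_sum _ _ _)); apply: ler_sum => i _.
  have K_ge0 : 0 <= K by apply: le_trans (b_le i i).
  rewrite !normrM (ger0_norm (_ : 0 <= 2)) // -[u j ^+ 2]real_normK ?num_real //.
  rewrite -[u i ^+ 2]real_normK ?num_real //.
  have b_le' : 2 * `|u j| * `|u i| * `|b i j| <= 2 * `|u j| * `|u i| * K.
    by apply: ler_wpM2l => //; rewrite !mulr_ge0.
  have := mulr_ge0 K_ge0 (sqr_ge0 (`|u j| - `|u i|)).
  move: b_le'; rewrite !mulrA; nra.
rewrite (eq_bigr (fun j => K * (n%:R * u j ^+ 2) + K * \sum_i u i ^+ 2)); last first.
  move=> j _; rewrite -mulr_sumr big_split /= sumr_const card_ord.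
  by rewrite mulrDr mulr_natl.
rewrite big_split /= sumr_const card_ord -!mulr_sumr.
rewrite [X in X <= _](_ : _ = 2 * n%:R * K * \sum_j u j ^+ 2) //.
by rewrite -mulr_natr; ring.
Qed.

Lemma bounded_on_interval (R : realType) (I : finType) (F : I -> R -> R) (a b : R) :
  a <= b -> (forall i, continuous (F i)) ->
  exists K, forall i s, a <= s <= b -> `|F i s| <= K.
Proof.
move=> a_le_b F_cont.
have each i : exists K, forall s, a <= s <= b -> `|F i s| <= K.
  have [|c _ c_max] := @EVT_max R (fun s => `|F i s|) a b a_le_b.
    apply: continuous_subspaceT => s.
    by apply: continuous_comp; [exact: F_cont | exact: norm_continuous].
  by exists `|F i c| => s s_in; apply: c_max; rewrite in_itv.
have [Kf Kf_bound] := fin_all_exists each.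
exists (\sum_i `|Kf i|) => i s s_in.
apply: le_trans (Kf_bound i s s_in) _; apply: le_trans (ler_norm _) _.
by rewrite (bigD1 i) //= lerDl; apply: sumr_ge0 => j _; exact: normr_ge0.
Qed.

(* The squared Euclidean norm s |-> |w(s)|^2 of a curve of row vectors, written
   as a sum of products of coordinate functions so that it can be differentiated. *)
Definition sqnorm_fun (R : realType) (N : nat) (w : R -> 'rV[R]_N) : R -> R :=
  \sum_(j < N) (fun s => w s 0 j) * (fun s => w s 0 j).

Lemma sqnorm_funE (R : realType) (N : nat) (w : R -> 'rV[R]_N) s :
  sqnorm_fun w s = \sum_j w s 0 j ^+ 2.
Proof. by rewrite /sqnorm_fun fct_sumE; apply: eq_bigr => j _; rewrite expr2. Qed.

Lemma sqnorm_fun_eq0 (R : realType) (N : nat) (w : R -> 'rV[R]_N) s :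
  sqnorm_fun w s = 0 -> w s = 0.
Proof.
rewrite sqnorm_funE => /psumr_eq0P w_eq0; apply/rowP => j; rewrite mxE.
by apply/eqP; rewrite -sqrf_eq0; apply/eqP/w_eq0 => // i _; exact: sqr_ge0.
Qed.

Section Uniqueness.
Variables (R : realType) (N : nat) (f : 'rV[R]_N -> R -> 'rV[R]_N).
Hypothesis f_C1 : C1 f.
Variable xs : R -> 'rV[R]_N.
Hypothesis xs_der : forall t, derivable xs t 1.
Notation solves := (solves_linearization f xs).

Let jac s i j := (Dxf f (xs s) s 'e_i) 0 j.

Lemma sqnorm_fun_derive w : solves w -> forall s,
  derivable (sqnorm_fun w) s 1 /\
  'D_1 (sqnorm_fun w) s = \sum_j 2 * w s 0 j * \sum_i w s 0 i * jac s i j.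
Proof.
move=> w_sol s.
have dwj j s' : derivable (fun s => w s 0 j) s' 1.
  exact: (derivable_mxP _ _ _).1 (w_sol s').1 0 j.
have Dwj j : 'D_1 (fun s => w s 0 j) s = (Dxf f (xs s) s (w s)) 0 j.
  by rewrite -(w_sol s).2 derive_mx ?mxE //; exact: (w_sol s).1.
split; first by apply: derivable_sum => j; apply: derivableM.
rewrite derive_sum; last by move=> j; apply: derivableM.
apply: eq_bigr => j _; rewrite deriveM // Dwj Dxf_coord //.
by rewrite /GRing.scale /=; ring.
Qed.

(* On [-|t|, |t|] the Jacobian is bounded by some K, so
   |(|w|^2)'| <= 2 N K |w|^2 and Gronwall's inequality applies. *)
Lemma linear_ode_unique w : solves w -> w 0 = 0 -> forall t, w t = 0.
Proof.
move=> w_sol w0 t; apply: sqnorm_fun_eq0.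
have jac_cont (p : 'I_N * 'I_N) : continuous (fun s => jac s p.1 p.2).
  move=> s; apply: (@continuous_comp _ _ _ (fun s => Dxf f (xs s) s 'e_p.1)
                                          (fun M : 'rV[R]_N => M 0 p.2)).
    exact: Dxf_continuous.
  exact: coord_continuous.
have [|K jac_le] := bounded_on_interval (a := - `|t|) (b := `|t|) _ jac_cont.
  by have := normr_ge0 t; lra.
apply: (gronwall (a := `|t|) (C := 2 * N%:R * K)).
- by move=> s; have [] := sqnorm_fun_derive w_sol s.
- by move=> s; rewrite sqnorm_funE; apply: sumr_ge0 => j _; exact: sqr_ge0.
- by rewrite sqnorm_funE w0; apply: big1 => j _; rewrite mxE expr0n.
- move=> s s_in; have [_ ->] := sqnorm_fun_derive w_sol s.
  rewrite sqnorm_funE; apply: quadratic_form_bound => i j.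
  exact: (jac_le (i, j)).
- by rewrite -ler_norml.
Qed.

End Uniqueness.

(* A real eigenvalue mu0 of the monodromy matrix, with eigenvector v, yields a
   Floquet solution y(t) = v Phi(t) of the linearization:
   y(t + T) = mu0 y(t), since both sides solve it and agree at t = 0. *)
Lemma floquet_solution (R : realType) (N : nat) (f : 'rV[R]_N -> R -> 'rV[R]_N)
    (T : R) (xs : R -> 'rV[R]_N) (Phi : R -> 'M[R]_N) (mu0 : R) (v : 'rV[R]_N) :
  C1 f -> (forall t, derivable xs t 1) ->
  (forall x t, f x (t + T) = f x t) -> (forall t, xs (t + T) = xs t) ->
  principal_fundamental f xs Phi -> v *m Phi T = mu0 *: v ->
  exists y, solves_linearization f xs y /\ y 0 = v /\
    forall t, y (t + T) = mu0 *: y t.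
Proof.
move=> f_C1 xs_der f_per xs_per [Phi0 rows_sol] v_eigen.
pose y := \sum_(i < N) v 0 i \*: (fun t => row i (Phi t)).
have yE t : y t = v *m Phi t.
  by rewrite /y fct_sumE mulmx_sum_row; apply: eq_bigr.
have y_sol : solves_linearization f xs y := solves_lin_sum f_C1 _ rows_sol.
exists y; split => //; split; first by rewrite yE Phi0 mulmx1.
pose w := (- mu0) \*: y + (fun s => y (s + T)).
have w_sol : solves_linearization f xs w.
  exact: (solves_lin_add f_C1 (solves_lin_scale f_C1 (- mu0) y_sol)
                            (solves_lin_shift f_per xs_per y_sol)).
have w0 : w 0 = 0.
  change (- mu0 *: y 0 + y (0 + T) = 0).
  by rewrite add0r !yE v_eigen Phi0 mulmx1 scaleNr addNr.
move=> t; apply/eqP; rewrite -subr_eq0 -scaleNr addrC.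
by rewrite -[_ + _]/(w t) (linear_ode_unique f_C1 xs_der w_sol w0).
Qed.

(* If y solves the linearization with y(t + T) = mu0 y(t), then
   z(t) = e^{ct} y(t) satisfies z(t - T) = e^{-cT} z(t) / mu0, hence solves the
   delayed linearization as soon as c is a root of the characteristic equation
   c = k (1 - e^{-cT} / mu0); moreover z(t + T) = e^{cT} mu0 z(t). *)
Lemma exponential_delayed_solution (R : realType) (N : nat)
    (f : 'rV[R]_N -> R -> 'rV[R]_N) (xs y : R -> 'rV[R]_N) (k T mu0 c : R) :
  C1 f -> solves_linearization f xs y -> (forall t, y (t + T) = mu0 *: y t) ->
  mu0 != 0 -> c = k - k * expR (- (c * T)) / mu0 ->
  let z t := expR (c * t) *: y t in
  solves_delayed_linearization f xs k T z /\
  forall t, z (t + T) = (expR (c * T) * mu0) *: z t.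
Proof.
move=> f_C1 y_sol y_per mu0_neq0 c_root z; split=> t; last first.
  by rewrite /z y_per mulrDr expRD !scalerA; congr (_ *: _); ring.
have [dz Dz] := is_derive_scale_fun (is_derive_expRM c t) (y_sol t).1.
split => //; rewrite Dz (y_sol t).2.
have y_back : y (t - T) = mu0^-1 *: y t.
  by rewrite -{2}(subrK T t) y_per scalerA mulVf // scale1r.
rewrite /z y_back mulrBr expRD !scalerA.
rewrite (Dxf_scale f_C1 _ _ (expR (c * t)) (y t)).
(* hide the c of e^{ct}, so that only the bare c gets replaced below *)
set e := expR (c * t); set E := expR (- (c * T)).
rewrite -scalerBl scalerA addrC; congr (_ + _); congr (_ *: _).
by rewrite {1}c_root -/E; ring.
Qed.

(* For T > 0 and mu0 > 1, the characteristic equation c = k (1 - e^{-cT} / mu0)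
   has a root with e^{cT} mu0 > 1: the function G(c) = c - k + k e^{-cT} / mu0
   satisfies G(c0) = c0 < 0 at c0 = -ln(mu0) / T and G(2|k|) >= 0, so the
   intermediate value theorem gives a root c > c0. *)
Lemma characteristic_root (R : realType) (T k mu0 : R) : 0 < T -> 1 < mu0 ->
  exists c : R, 1 < expR (c * T) * mu0 /\ c = k - k * expR (- (c * T)) / mu0.
Proof.
move=> T_gt0 mu0_gt1.
have mu0_gt0 : 0 < mu0 by lra.
pose G := ((@id R) - cst k) + (cst (k / mu0) * (fun c : R => expR (- T * c))).
have GE c : G c = c - k + k * expR (- (c * T)) / mu0.
  change (c - k + k / mu0 * expR (- T * c) = c - k + k * expR (- (c * T)) / mu0).
  by rewrite mulNr (mulrC T c) mulrAC.
have G_cont : continuous G.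
  move=> c; apply: continuousD.
    by apply: continuousB; [exact: cvg_id | exact: cvg_cst].
  apply: continuousM; first exact: cvg_cst.
  apply: differentiable_continuous; apply/derivable1_diffP.
  by have [] := is_derive_expRM (- T) c.
have [y0 expR_y0] := expR_total (ltac:(by rewrite invr_gt0) : 0 < mu0^-1).
pose c0 := y0 / T.
have c0T : c0 * T = y0 by rewrite /c0 divfK // gt_eqF.
have c0_lt0 : c0 < 0.
  by rewrite /c0 pmulr_llt0 ?invr_gt0 // -expR_lt1 expR_y0 invf_lt1.
have G_c0 : G c0 = c0 by rewrite GE c0T expRN expR_y0 invrK mulfK ?gt_eqF //; ring.
pose b := 2 * `|k|.
have b_ge0 : 0 <= b by rewrite /b mulr_ge0 // normr_ge0.
have G_b : 0 <= G b.
  have q_le1 : expR (- (b * T)) / mu0 <= 1.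
    rewrite ler_pdivrMr // mul1r (le_trans _ (ltW mu0_gt1)) //.
    by rewrite expR_le1 oppr_le0 mulr_ge0 // ltW.
  have q_ge0 : 0 <= expR (- (b * T)) / mu0 by rewrite divr_ge0 ?expR_ge0 // ltW.
  rewrite GE -mulrA; set q := expR (- (b * T)) / mu0 in q_le1 q_ge0 *.
  have := ler_norm (- (k * q)); rewrite normrN normrM (ger0_norm q_ge0).
  have := ler_wpM2l (normr_ge0 k) q_le1; rewrite mulr1.
  have := ler_norm k; rewrite /b; lra.
have [c c_in Gc] : exists2 c, c \in `[c0, b] & G c = 0.
  apply: (IVT (ltW (lt_le_trans c0_lt0 b_ge0)) (continuous_subspaceT G_cont)).
  by rewrite G_c0 ge_min le_max G_b ltW ?orbT.
have c0_lt_c : c0 < c.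
  rewrite lt_neqAle (itvP c_in) andbT; apply/eqP => c0_eq.
  by move: Gc c0_lt0; rewrite -c0_eq G_c0 => ->; rewrite ltxx.
exists c; split; last by move: Gc; rewrite GE; lra.
by rewrite -(mulVf (lt0r_neq0 mu0_gt0)) -expR_y0 ltr_pM2r // ltr_expR -c0T ltr_pM2r.
Qed.

Theorem corollary2 (R : realType) (N : nat) (f : 'rV[R]_N -> R -> 'rV[R]_N)
  (T : R) (xs : R -> 'rV[R]_N) :
  0 < T ->
  C1 f ->
  (forall x t, f x (t + T) = f x t) ->
  is_solution f xs ->
  (forall t, xs (t + T) = xs t) ->
  (exists mu : R, 1 < mu /\ ode_floquet_multiplier f xs T mu) ->
  forall k : R, exists mu : R, 1 < mu /\ dde_floquet_multiplier f xs k T mu.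
Proof.
move=> T_gt0 f_C1 f_per xs_sol xs_per [mu0 [mu0_gt1 [Phi [Phi_fund mu0_eigen]]]] k.
have xs_der t : derivable xs t 1 := (xs_sol t).1.
have [v v_eigen v_neq0] := eigenvalueP mu0_eigen.
have [y [y_sol [y0 y_per]]] :=
  floquet_solution f_C1 xs_der f_per xs_per Phi_fund v_eigen.
have [c [mu_gt1 c_root]] := characteristic_root k T_gt0 mu0_gt1.
have mu0_neq0 : mu0 != 0 by rewrite gt_eqF //; lra.
have [z_sol z_per] := exponential_delayed_solution f_C1 y_sol y_per mu0_neq0 c_root.
exists (expR (c * T) * mu0); split => //; split.
  by rewrite mulf_neq0 // gt_eqF ?expR_gt0.
exists (fun t => expR (c * t) *: y t); split => //; split => //.
by exists 0; rewrite mulr0 expR0 scale1r y0.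
Qed.
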